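(* Let $X$ be a set equipped with a well-founded strict relation $\prec$. Let $B\subseteq X$ (the base predicate) and $R\subseteq X$ (the predicate of reducible objects) be predicates on $X$, let $\delta:\{y\in X\mid R(y)\}\to X$ be a map (the reduction map), let $\sim$ be a binary relation on $X$ (the local transport relation, not assumed to be an equivalence relation), and let $P:X\to\mathrm{Prop}$ be a property. Suppose that (1) $P(x)$ holds for every $x\in B$; (2) for every $x\notin B$, there are $y\in X$ and a proof $h_y:R(y)$ such that $y\sim x$ and $\delta(y,h_y)\prec x$; (3) for every $y\in X$ and every $h_y:R(y)$, $P(\delta(y,h_y))$ implies $P(y)$; (4) for all $x,y\in X$, $y\sim x$ and $P(y)$ imply $P(x)$. Then $P(x)$ holds for every $x\in X$.
   Context: $\delta(y,h_y)$ denotes the value of the map $\delta$ at the element $y$ together with a proof $h_y$ that $R(y)$ holds. The relation $\prec$ being well-founded means that well-founded induction along $\prec$ is valid (there are no infinite $\prec$-descending chains). Nothing else is assumed about $B$, $R$, $\delta$, $\sim$, $P$. *)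

From Stdlib Require Import Classical.

Theorem theorem1
  (X : Type) (prec : X -> X -> Prop) (prec_wf : well_founded prec)
  (B R : X -> Prop) (delta : {y : X | R y} -> X)
  (sim : X -> X -> Prop) (P : X -> Prop)
  (base : forall x : X, B x -> P x)
  (reduce : forall x : X, ~ B x ->
     exists (y : X) (hy : R y), sim y x /\ prec (delta (exist R y hy)) x)
  (lift : forall (y : X) (hy : R y), P (delta (exist R y hy)) -> P y)
  (transport : forall x y : X, sim y x -> P y -> P x) :
  forall x : X, P x.
Proof.
  intro x; induction x as [x IH] using (well_founded_ind prec_wf).
  (* [B] is not assumed decidable and [reduce] asks for a refutation of [B x], hence the classical
     case split. *)
  destruct (classic (B x)) as [Bx | nBx]; [now apply base |].
  destruct (reduce x nBx) as (y & hy & Hsim & Hprec).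
  (* Only the reduct of [y] is known to lie below [x], not [y] itself, so [IH] is used at
     [delta (exist R y hy)]; from there [P] passes up to [y] by [lift] and then across [sim] to [x]
     by [transport]. *)
  apply (transport x y Hsim), (lift y hy), IH, Hprec.
Qed.
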